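(* Let $G$ be a finite nonabelian simple group, $x\in G$ an involution, $\alpha=\sigma_x$, and $n$ a divisor of $|G|$. If $\Delta_\alpha$ acts transitively on $\Omega^*_x(G,n)$, then the elements of order $n$ of $G$ lie in at most two $\mathrm{Aut}(G)$-orbits (fusion classes).
   Context: $\sigma_x$ is conjugation $y\mapsto xyx$. $\mathrm{Aut}(G)_\alpha=\{\gamma\in\mathrm{Aut}(G):\gamma\alpha=\alpha\gamma\}$ and $\Delta_\alpha=\mathrm{Inn}(G)\,\mathrm{Aut}(G)_\alpha$. Define $\Omega_x(G,n)=\{\{xg,g^{-1}x^{-1}\}: g\in G,\ o(xg)=n\}$ (equivalently, the set of all unordered pairs $\{h,h^{-1}\}$ with $h\in G$ of order $n$), and $\Omega^*_x(G,n)=\Omega_x(G,n)$ for $n\neq 2$, while $\Omega^*_x(G,2)$ is $\Omega_x(G,2)$ with the singletons $\{hxh^{-1}\}$ ($h\in G$), i.e. the conjugacy class of $x$, removed. $\Delta_\alpha$ acts on these sets by $\delta\cdot\{h,h^{-1}\}=\{\delta(h),\delta(h)^{-1}\}$; an action on the empty set counts as transitive. *)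

(* Defs.v *)
From mathcomp Require Import all_boot all_fingroup all_solvable.

Set Implicit Arguments.
Unset Strict Implicit.
Unset Printing Implicit Defensive.

Import GroupScope.

Section FusionDefs.

Variables (gT : finGroupType) (G : {group gT}).
Implicit Types (x y h : gT) (n : nat).

(* Only meaningful for x \in G; permutations in Aut G fix every element of gT
   outside G.  As x is an involution, y ^ x = x^-1 * y * x is x * y * x: see
   sigmaE. *)
Definition sigma x : {perm gT} := conj_aut G x.

Definition Inn : {set {perm gT}} := conj_aut G @* G.

Definition Aut_fix (alpha : {perm gT}) : {set {perm gT}} :=
  [set gamma in Aut G | gamma * alpha == alpha * gamma].

(* Products of permutations are composed from left to right, but this product
   set is a group because Inn is normalised by Aut G, so the order of the two
   factors is irrelevant. *)
Definition Delta (alpha : {perm gT}) : {set {perm gT}} := Inn * Aut_fix alpha.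

Definition Omega x n : {set {set gT}} :=
  [set [set x * g; g^-1 * x^-1] | g in G & #[x * g] == n].

Definition Omega_star x n : {set {set gT}} :=
  if n == 2 then Omega x 2 :\: [set [set h * x * h^-1] | h in G]
  else Omega x n.

(* The library's [transitive A, on S | to] is false for S = set0. *)
Definition transitive_on (A : {set {perm gT}}) (S : {set {set gT}}) : bool :=
  (S == set0) || [transitive A, on S | 'P^*].

Definition elements_of_order n : {set gT} := [set h in G | #[h] == n].

Definition fusion_classes n : {set {set gT}} :=
  orbit 'P (Aut G) @: elements_of_order n.

Lemma sigmaE x y : x \in G -> #[x] = 2 -> y \in G -> sigma x y = x * y * x.
Proof.
move=> Gx ox Gy; rewrite /sigma conj_autE // conjgE mulgA.
suff -> : x^-1 = x by [].
by apply/eqP; rewrite eq_invg_mul -expg2 -ox expg_order.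
Qed.

Lemma OmegaE x n : x \in G ->
  Omega x n = [set [set h; h^-1] | h in elements_of_order n].
Proof.
move=> Gx; apply/setP => P; apply/imsetP/imsetP => -[g].
  rewrite inE => /andP[Gg og] ->; exists (x * g); last by rewrite invMg.
  by rewrite inE groupM.
rewrite inE => /andP[Gg og] ->; exists (x^-1 * g); last first.
  by rewrite -invMg mulKVg.
by rewrite inE mulKVg og groupM ?groupV.
Qed.

Lemma pair_actE (d : {perm gT}) h : d \in Aut G -> h \in G ->
  ('P^*)%act [set h; h^-1] d = [set d h; (d h)^-1].
Proof.
move=> Ad Gh; have dV : d h^-1 = (d h)^-1.
  by rewrite -(autmE Ad) morphV.
by rewrite /= /setact imsetU1 imset_set1 /= /aperm dV.
Qed.

End FusionDefs.

(* Main.v *)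
Require Import Defs.
From mathcomp Require Import all_boot all_fingroup all_solvable.

(** Since Delta_alpha consists of automorphisms, a transitive action on the pairs
    {h, h^-1} leaves only the fusion classes of a and a^-1, for a fixed a.  When
    n = 2 these two coincide, and the conjugates of x that were removed from
    Omega contribute the second class. *)

Section FusionClasses.

Set Implicit Arguments.
Unset Strict Implicit.
Unset Printing Implicit Defensive.

Local Open Scope group_scope.

Variables (gT : finGroupType) (G : {group gT}).

Lemma Delta_subset_Aut (alpha : {perm gT}) : Delta G alpha \subset Aut G.
Proof.
rewrite mul_subG ?Aut_conj_aut //.
by apply/subsetP => d; rewrite inE => /andP[].
Qed.

(** The orbits of [a] and [b] may coincide, and neither element need have order [n]; this lets
    degenerate cases use an arbitrary pair. *)
Lemma card_fusion_classes_le2 (n : nat) (a b : gT) :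
    {in elements_of_order G n, forall h,
       h \in orbit 'P (Aut G) a \/ h \in orbit 'P (Aut G) b} ->
  #|fusion_classes G n| <= 2.
Proof.
move=> orb_ab.
apply: (@leq_trans #|[set orbit 'P (Aut G) a; orbit 'P (Aut G) b]|); last first.
  by rewrite cards2; case: (_ != _).
apply/subset_leq_card/subsetP => _ /imsetP[h nh ->]; rewrite !inE.
by case: (orb_ab h nh) => /orbit_eqP ->; rewrite eqxx ?orbT.
Qed.

(** If [d] carries one pair to the other, then [h] is [d a] or [(d a)^-1], and the latter is
    [d a^-1] because [d] is an automorphism. *)
Lemma orbit_pair_fusion (A : {set {perm gT}}) (a h : gT) :
    A \subset Aut G -> a \in G ->
    [set h; h^-1] \in orbit 'P^* A [set a; a^-1] ->
  h \in orbit 'P (Aut G) a \/ h \in orbit 'P (Aut G) a^-1.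
Proof.
move=> sAAut Ga /imsetP[d /(subsetP sAAut) Ad].
rewrite (pair_actE Ad Ga) => /setP/(_ h); rewrite !inE eqxx /=.
case/esym/orP => /eqP ->; [left | right]; apply/imsetP; exists d => //=.
by rewrite /aperm -(autmE Ad) morphV.
Qed.

(** The first alternative reflects the convention on empty sets. In the second, [a] is taken in [D]
    so that its order remains known. *)
Lemma transitive_on_pair_fusion (A : {set {perm gT}}) (S : {set {set gT}})
    (D : {set gT}) :
    A \subset Aut G -> D \subset G -> S \subset [set [set h; h^-1] | h in D] ->
    transitive_on A S ->
  S = set0 \/ exists2 a, a \in D & forall h, [set h; h^-1] \in S ->
    h \in orbit 'P (Aut G) a \/ h \in orbit 'P (Aut G) a^-1.
Proof.
move=> sAAut sDG sSD /orP[/eqP -> | /imsetP[P SP defS]]; [by left | right].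
have /imsetP[a Da defP] := subsetP sSD P SP.
exists a => // h; rewrite {1}defS defP.
exact: orbit_pair_fusion sAAut (subsetP sDG a Da).
Qed.

Lemma invg_order2 (h : gT) : #[h] = 2 -> h^-1 = h.
Proof. by move=> oh; apply/eqP; rewrite eq_invg_mul -expg2 -oh expg_order. Qed.

(** The inner automorphism by [h^-1] is the witness, since [x ^ h^-1] unfolds to [h * x * h^-1]. *)
Lemma conj_in_Aut_orbit (x h : gT) :
  x \in G -> h \in G -> h * x * h^-1 \in orbit 'P (Aut G) x.
Proof.
move=> Gx Gh; apply/imsetP; exists (conj_aut G h^-1).
  by rewrite (subsetP (Aut_conj_aut G G)) ?mem_morphim ?(subsetP (normG G)) ?groupV.
rewrite /= /aperm norm_conj_autE ?(subsetP (normG G)) ?groupV //.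
by rewrite conjgE invgK mulgA.
Qed.

End FusionClasses.

Theorem theorem3p1 (gT : finGroupType) (G : {group gT}) (x : gT) (n : nat)
    (simpleG : simple G) (nonabelianG : ~~ abelian G)
    (Gx : x \in G) (ox : #[x]%g = 2) (n_dvd_G : n %| #|G|)
    (transDelta : transitive_on (Delta G (sigma G x)) (Omega_star G x n)) :
  #|fusion_classes G n| <= 2.
Proof.
have sEG : elements_of_order G n \subset G.
  by apply/subsetP => h; rewrite inE => /andP[].
have sOmega : Omega_star G x n
    \subset [set [set h; h^-1%g] | h in elements_of_order G n].
  rewrite /Omega_star -(OmegaE n Gx); case: eqP => [-> | _ //].
  exact: subsetDl.
have := transitive_on_pair_fusion (Delta_subset_Aut G _) sEG sOmega transDelta.
rewrite /Omega_star; case: eqP => [n2 | _] fusion; last first.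
  have inOmega h : h \in elements_of_order G n -> [set h; h^-1%g] \in Omega G x n.
    by move=> nh; rewrite OmegaE //; apply: imset_f.
  case: fusion => [Omega0 | [a _ fus]].
    (* There are no elements of order [n] here, so [x] is a mere placeholder. *)
    apply: (@card_fusion_classes_le2 _ _ _ x x) => h /inOmega.
    by rewrite Omega0 inE.
  by apply: (@card_fusion_classes_le2 _ _ _ a a^-1%g) => h /inOmega/fus.
subst n; set S := (_ :\: _)%SET in fusion.
have S_or_x h : h \in elements_of_order G 2 ->
    [set h; h^-1%g] \in S \/ h \in orbit 'P (Aut G) x.
  move=> h2; have [xh | notxh] := boolP
    ([set h; h^-1%g] \in [set [set (k * x * k^-1)%g] | k in G]); last first.
    by left; rewrite inE notxh OmegaE //; apply: imset_f.
  (* The pair equals a singleton containing [h], which forces [h = k * x * k^-1]. *)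
  right; have /imsetP[k Gk /setP/(_ h)] := xh; rewrite !inE eqxx => /esym/eqP ->.
  exact: conj_in_Aut_orbit.
case: fusion => [S0 | [a a2 fus]].
  apply: (@card_fusion_classes_le2 _ _ _ x x) => h /S_or_x.
  by rewrite S0 inE => -[ | xh] //; left.
apply: (@card_fusion_classes_le2 _ _ _ x a) => h /S_or_x [/fus | xh]; last by left.
(* An involution is its own inverse, so [S] accounts for one class only, leaving room for that of
   [x]. *)
have -> : a^-1%g = a.
  by apply: invg_order2; move: a2; rewrite inE => /andP[_ /eqP].
by case; right.
Qed.
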